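(* Let $(\mathscr A,\mathscr B,\mathscr C)$ be a recollement of abelian categories (with enough projectives and enough injectives) such that $\mathscr A$ is a finite length category and $\mathscr B$ has projective covers. Assume that the functor $\mathsf e\colon\mathscr B\to\mathscr C$ is a $t$-eventually homological isomorphism. Then: (i) $\operatorname{Fin.dim}\mathscr C\le\max\{\operatorname{Fin.dim}\mathscr B,t\}$. (ii) $\operatorname{Fin.dim}\mathscr B\le\max\{\operatorname{Fin.dim}\mathscr C,t\}$. In particular, $\operatorname{Fin.dim}\mathscr B$ is finite if and only if $\operatorname{Fin.dim}\mathscr C$ is finite.
   Context: A recollement $(\mathscr A,\mathscr B,\mathscr C)$ of abelian categories consists of functors $\mathsf i\colon\mathscr A\to\mathscr B$, $\mathsf e\colon\mathscr B\to\mathscr C$, $\mathsf q,\mathsf p\colon\mathscr B\to\mathscr A$, $\mathsf l,\mathsf r\colon\mathscr C\to\mathscr B$ such that $(\mathsf l,\mathsf e)$, $(\mathsf e,\mathsf r)$, $(\mathsf q,\mathsf i)$, $(\mathsf i,\mathsf p)$ are adjoint pairs, the functors $\mathsf i,\mathsf l,\mathsf r$ are fully faithful, and the essential image of $\mathsf i$ equals $\operatorname{Ker}\mathsf e=\{B\in\mathscr B\mid\mathsf e(B)=0\}$. A functor $E\colon\mathscr B\to\mathscr C$ between abelian categories is an eventually homological isomorphism if there is a positive integer $t$ such that for every $n>t$ and all objects $B,B'$ of $\mathscr B$ there is a group isomorphism $\operatorname{Ext}^n_{\mathscr B}(B,B')\simeq\operatorname{Ext}^n_{\mathscr C}(E(B),E(B'))$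 (not required to be induced by $E$); for the minimal such $t$ it is called a $t$-eventually homological isomorphism. For an abelian category $\mathscr A$ with enough projectives, $\operatorname{Fin.dim}\mathscr A=\sup\{\operatorname{pd}_{\mathscr A}A\mid A\in\mathscr A,\ \operatorname{pd}_{\mathscr A}A<\infty\}$. A finite length category is one in which every object has a finite composition series; having projective covers means every object has a projective cover. *)

(* Defs.v *)
From HB Require Import structures.
From mathcomp Require Import all_boot all_order all_algebra.
From mathcomp Require Import boolp classical_sets reals constructive_ereal ereal.

Set Implicit Arguments.
Unset Strict Implicit.
Unset Printing Implicit Defensive.

Import Order.TTheory GRing.Theory Num.Theory.
Local Open Scope ring_scope.

HB.mixin Record isPreadditive (Ob : Type) := {
  hom : Ob -> Ob -> zmodType;
  idm : forall X : Ob, hom X X;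
  (* [compm g f] is [f] followed by [g]. *)
  compm : forall {X Y Z : Ob}, hom Y Z -> hom X Y -> hom X Z;
  compA : forall (W X Y Z : Ob) (h : hom Y Z) (g : hom X Y) (f : hom W X),
    compm h (compm g f) = compm (compm h g) f;
  comp1m : forall (X Y : Ob) (f : hom X Y), compm (idm Y) f = f;
  compm1 : forall (X Y : Ob) (f : hom X Y), compm f (idm X) = f;
  compDl : forall (X Y Z : Ob) (g g' : hom Y Z) (f : hom X Y),
    compm (g + g') f = compm g f + compm g' f;
  compDr : forall (X Y Z : Ob) (g : hom Y Z) (f f' : hom X Y),
    compm g (f + f') = compm g f + compm g f'
}.

#[short(type="preadditiveType")]
HB.structure Definition Preadditive := { Ob of isPreadditive Ob }.

Arguments idm {s} X.
Arguments compm {s X Y Z} g f.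

Notation "g \oc f" := (compm g f) (at level 40, left associativity).

Section Morphisms.
Context {C : preadditiveType}.

Definition mono {X Y : C} (f : hom X Y) : Prop :=
  forall (W : C) (g h : hom W X), f \oc g = f \oc h -> g = h.

Definition epi {X Y : C} (f : hom X Y) : Prop :=
  forall (Z : C) (g h : hom Y Z), g \oc f = h \oc f -> g = h.

Definition iso_mor {X Y : C} (f : hom X Y) : Prop :=
  exists g : hom Y X, g \oc f = idm X /\ f \oc g = idm Y.

Definition isomorphic (X Y : C) : Prop := exists f : hom X Y, iso_mor f.

(* Both initial and terminal; existence of morphisms is automatic here. *)
Definition zero_object (Z : C) : Prop :=
  forall X : C, (forall f g : hom X Z, f = g) /\ (forall f g : hom Z X, f = g).

Definition is_biproduct (X Y B : C) : Prop :=
  exists (i1 : hom X B) (i2 : hom Y B) (p1 : hom B X) (p2 : hom B Y),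
    [/\ p1 \oc i1 = idm X, p2 \oc i2 = idm Y,
        p1 \oc i2 = 0, p2 \oc i1 = 0 &
        i1 \oc p1 + i2 \oc p2 = idm B].

Definition is_kernel {X Y K : C} (k : hom K X) (f : hom X Y) : Prop :=
  f \oc k = 0 /\
  forall (W : C) (g : hom W X), f \oc g = 0 -> exists! h : hom W K, k \oc h = g.

Definition is_cokernel {X Y Q : C} (q : hom Y Q) (f : hom X Y) : Prop :=
  q \oc f = 0 /\
  forall (Z : C) (g : hom Y Z), g \oc f = 0 -> exists! h : hom Q Z, h \oc q = g.

(* Exactness at the middle object: [f] is an epimorphism onto [Ker g]. *)
Definition exact_at {X Y Z : C} (f : hom X Y) (g : hom Y Z) : Prop :=
  exists (K : C) (k : hom K Y) (p : hom X K),
    [/\ is_kernel k g, epi p & f = k \oc p].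

Definition short_exact {X Y Z : C} (f : hom X Y) (g : hom Y Z) : Prop :=
  [/\ mono f, exact_at f g & epi g].

End Morphisms.

HB.mixin Record isAbelian (Ob : Type) of isPreadditive Ob := {
  zero_object_exists : exists Z : Ob, zero_object Z;
  biproduct_exists : forall X Y : Ob, exists B : Ob, is_biproduct X Y B;
  kernel_exists : forall (X Y : Ob) (f : hom X Y),
    exists (K : Ob) (k : hom K X), is_kernel k f;
  cokernel_exists : forall (X Y : Ob) (f : hom X Y),
    exists (Q : Ob) (q : hom Y Q), is_cokernel q f;
  mono_normal : forall (X Y : Ob) (f : hom X Y), mono f ->
    exists (Z : Ob) (g : hom Y Z), is_kernel f g;
  epi_normal : forall (X Y : Ob) (f : hom X Y), epi f ->
    exists (W : Ob) (g : hom W X), is_cokernel f g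
}.

#[short(type="abelianType")]
HB.structure Definition Abelian := { Ob of isPreadditive Ob & isAbelian Ob }.

Section Objects.
Context {C : preadditiveType}.

Definition projective (P : C) : Prop :=
  forall (X Y : C) (p : hom X Y) (f : hom P Y), epi p ->
    exists g : hom P X, p \oc g = f.

Definition injective_object (I : C) : Prop :=
  forall (X Y : C) (j : hom X Y) (f : hom X I), mono j ->
    exists g : hom Y I, g \oc j = f.

(* A projective object with an essential (superfluous) epimorphism onto [X]. *)
Definition is_projective_cover {P X : C} (p : hom P X) : Prop :=
  [/\ projective P, epi p &
      forall (Y : C) (f : hom Y P), epi (p \oc f) -> epi f].

Definition simple_object (S : C) : Prop :=
  ~ zero_object S /\
  forall (Y : C) (j : hom Y S), mono j -> zero_object Y \/ iso_mor j.

(* A chain 0 = F 0 >-> F 1 >-> ... >-> F n = X with simple factors; the values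
   of [F] and [j] beyond [n] are irrelevant. *)
Definition has_composition_series (X : C) : Prop :=
  exists (n : nat) (F : nat -> C) (j : forall k, hom (F k) (F k.+1)),
    [/\ zero_object (F 0%N), isomorphic (F n) X &
        forall k, (k < n)%N ->
          exists (S : C) (p : hom (F k.+1) S),
            simple_object S /\ short_exact (j k) p].

End Objects.

Definition enough_projectives (C : preadditiveType) : Prop :=
  forall X : C, exists (P : C) (p : hom P X), projective P /\ epi p.

Definition enough_injectives (C : preadditiveType) : Prop :=
  forall X : C, exists (I : C) (j : hom X I), injective_object I /\ mono j.

Definition has_projective_covers (C : preadditiveType) : Prop :=
  forall X : C, exists (P : C) (p : hom P X), is_projective_cover p.

Definition finite_length_category (C : preadditiveType) : Prop :=
  forall X : C, has_composition_series X.

Record projres {C : preadditiveType} (X : C) := ProjRes {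
  pr_obj :> nat -> C;
  pr_diff : forall n, hom (pr_obj n.+1) (pr_obj n);
  pr_aug : hom (pr_obj 0%N) X;
  pr_projective : forall n, projective (pr_obj n);
  pr_aug_epi : epi pr_aug;
  pr_exact0 : exact_at (pr_diff 0) pr_aug;
  pr_exact : forall n, exact_at (pr_diff n.+1) (pr_diff n)
}.

Section ProjresExists.
Context {C : abelianType} (enoughP : enough_projectives C).

Let arrow := {Y : C & {P : C & hom P Y}}.
Let tgt (a : arrow) : C := projT1 a.
Let src (a : arrow) : C := projT1 (projT2 a).
Let mor (a : arrow) : hom (src a) (tgt a) := projT2 (projT2 a).

Let cover_kernel (a : arrow) : exists Q : {Q : C & hom Q (src a)},
  projective (projT1 Q) /\ exact_at (projT2 Q) (mor a).
Proof.
have [K [k kK]] := kernel_exists _ _ (mor a).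
have [Q [q [projQ epiq]]] := enoughP K.
exists (existT _ Q (k \oc q)); split=> //=.
by exists K, k, q.
Qed.

Let next (a : arrow) : arrow :=
  let Q := projT1 (cid (cover_kernel a)) in
  existT _ (src a) (existT _ (projT1 Q) (projT2 Q)).

Lemma projres_exists (X : C) : exists P : projres X, True.
Proof.
have [P0 [p0 [projP0 epip0]]] := enoughP X.
pose a n : arrow := iter n next (existT _ X (existT _ P0 p0)).
have nextP b : projective (src (next b)) /\ exact_at (mor (next b)) (mor b).
  by rewrite /next; case: (cid (cover_kernel b)).
suff projP n : projective (src (a n)).
  exists (@ProjRes C X (fun n => src (a n)) (fun n => mor (a n.+1)) p0
    projP epip0 (nextP (a 0%N)).2 (fun n => (nextP (a n.+1)).2)).
  by [].
by case: n => [|n] //; have [] := nextP (a n).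
Qed.

Definition chosen_projres (X : C) : projres X := projT1 (cid (projres_exists X)).

End ProjresExists.

Section ExtOfResolution.
Context {C : preadditiveType} {X : C} (P : projres X).

Lemma comp0m (U V W : C) (f : hom U V) : (0 : hom V W) \oc f = 0.
Proof. by apply: (addIr (0 \oc f)); rewrite -compDl !add0r. Qed.

Lemma compBl (U V W : C) (g h : hom V W) (f : hom U V) :
  (g - h) \oc f = g \oc f - h \oc f.
Proof. by apply: (addIr (h \oc f)); rewrite -compDl !subrK. Qed.

Definition is_cocycle (n : nat) (Y : C) : {pred hom (P n) Y} :=
  [pred f | f \oc pr_diff P n == 0].

Definition is_coboundary (n : nat) (Y : C) : {pred hom (P n) Y} :=
  match n with
  | 0%N => [pred f | f == 0]
  | m.+1 => [pred f | `[< exists g : hom (P m) Y, f = g \oc pr_diff P m >]]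
  end.

Arguments is_cocycle : clear implicits.
Arguments is_coboundary : clear implicits.

Lemma is_cocycle_zmod_closed n Y : zmod_closed (is_cocycle n Y).
Proof.
split=> [|f g]; rewrite !inE ?comp0m // => /eqP f0 /eqP g0.
by rewrite compBl f0 g0 subrr.
Qed.
HB.instance Definition _ n Y :=
  GRing.isZmodClosed.Build (hom (P n) Y) (is_cocycle n Y)
    (is_cocycle_zmod_closed n Y).

Lemma is_coboundary_zmod_closed n Y : zmod_closed (is_coboundary n Y).
Proof.
case: n => [|m]; split=> [|f g]; rewrite !inE //.
- by move=> /eqP-> /eqP->; rewrite subrr.
- by exists 0; rewrite comp0m.
by move=> [f' ->] [g' ->]; exists (f' - g'); rewrite compBl.
Qed.

Record cocycles (n : nat) (Y : C) := Cocycle {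
  cocycle_val :> hom (P n) Y;
  _ : cocycle_val \in is_cocycle n Y
}.
HB.instance Definition _ n Y := [isSub for @cocycle_val n Y].
HB.instance Definition _ n Y := [Choice of cocycles n Y by <:].
HB.instance Definition _ n Y :=
  [SubChoice_isSubZmodule of cocycles n Y by <:].

Definition coboundaries (n : nat) (Y : C) : {pred cocycles n Y} :=
  [pred z | val z \in is_coboundary n Y].

Arguments coboundaries : clear implicits.

Lemma coboundaries_zmod_closed n Y : zmod_closed (coboundaries n Y).
Proof.
have [c0 cB] := is_coboundary_zmod_closed n Y.
by split=> [|u v]; rewrite !inE ?raddf0 // raddfB; apply: cB.
Qed.
HB.instance Definition _ n Y :=
  GRing.isZmodClosed.Build (cocycles n Y) (coboundaries n Y)
    (coboundaries_zmod_closed n Y).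

(* The n-th cohomology group of the complex Hom(P, Y), where Hom(P_(-1), Y) = 0. *)
Definition Ext_of (n : nat) (Y : C) : zmodType :=
  Quotient.quot (coboundaries n Y).

End ExtOfResolution.

Definition Ext {C : abelianType} (enoughP : enough_projectives C)
    (n : nat) (X Y : C) : zmodType :=
  Ext_of (chosen_projres enoughP X) n Y.

Definition zmod_isomorphic (U V : zmodType) : Prop :=
  exists f : {additive U -> V}, bijective f.

Section Dimensions.
Context {R : realType} {C : preadditiveType}.
Local Open Scope classical_set_scope.
Local Open Scope ereal_scope.

Definition pd_le (X : C) (n : nat) : Prop :=
  exists P : projres X, forall m, (n < m)%N -> zero_object (P m).

(* Dimensions live in the extended reals, so that +oo is the infimum of the
   empty set; the zero object has dimension 0. *)
Definition pd (X : C) : \bar R :=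
  ereal_inf [set n%:R%:E | n in [set n : nat | pd_le X n]].

Definition Findim : \bar R :=
  ereal_sup [set x | exists2 X : C, pd X < +oo & x = pd X].

End Dimensions.

Arguments Findim R C : clear implicits.

(* Additivity is not required; functors having an adjoint are additive. *)
Record functor (C D : preadditiveType) := Functor {
  fobj :> C -> D;
  fmap : forall {X Y : C}, hom X Y -> hom (fobj X) (fobj Y);
  fmap1 : forall X : C, fmap (idm X) = idm (fobj X);
  fmapM : forall (X Y Z : C) (g : hom Y Z) (f : hom X Y),
    fmap (g \oc f) = fmap g \oc fmap f
}.

(* [L] is left adjoint to [R]. *)
Definition adjoint_pair {C D : preadditiveType}
    (L : functor C D) (R : functor D C) : Prop :=
  exists phi : forall (X : C) (Y : D), hom (L X) Y -> hom X (R Y),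
    (forall X Y, bijective (phi X Y)) /\
    (forall (X X' : C) (Y Y' : D) (f : hom X' X) (g : hom Y Y')
            (h : hom (L X) Y),
       phi X' Y' (g \oc h \oc fmap L f) = fmap R g \oc phi X Y h \oc f).

Definition fully_faithful {C D : preadditiveType} (F : functor C D) : Prop :=
  forall X Y : C, bijective (@fmap C D F X Y).

Record recollement (A B C : abelianType) := Recollement {
  rec_i : functor A B;
  rec_e : functor B C;
  rec_q : functor B A;
  rec_p : functor B A;
  rec_l : functor C B;
  rec_r : functor C B;
  rec_le : adjoint_pair rec_l rec_e;
  rec_er : adjoint_pair rec_e rec_r;
  rec_qi : adjoint_pair rec_q rec_i;
  rec_ip : adjoint_pair rec_i rec_p;
  rec_i_ff : fully_faithful rec_i;
  rec_l_ff : fully_faithful rec_l;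
  rec_r_ff : fully_faithful rec_r;
  rec_im_ker : forall X : B,
    (exists Y : A, isomorphic (rec_i Y) X) <-> zero_object (rec_e X)
}.

Section EventuallyHomological.
Context {B C : abelianType}.
Context (hB : enough_projectives B) (hC : enough_projectives C).

Definition Ext_iso_above (E : functor B C) (t : nat) : Prop :=
  forall (n : nat) (X Y : B), (t < n)%N ->
    zmod_isomorphic (Ext hB n X Y) (Ext hC n (E X) (E Y)).

Definition t_eventually_homological_iso (E : functor B C) (t : nat) : Prop :=
  [/\ (0 < t)%N, Ext_iso_above E t &
      forall s, (0 < s)%N -> Ext_iso_above E s -> (t <= s)%N].

End EventuallyHomological.

(* Main.v *)
(* An object has projective dimension at most n exactly when its Ext groups
   vanish above n, so above degree t only the vanishing of Ext has to be moved
   between B and C along e, and for that non-natural isomorphisms suffice.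
   Since e l = id and e r = id, every object of C, as first or as second
   argument of Ext, comes from B; hence pd (l X) <= max(pd X, t) and
   pd (e X) <= max(pd X, t), and conversely pd X <= max(pd (e X), t), all of
   them read off from Ext(X, Y) = Ext(e X, e Y) above t. Finiteness of one
   dimension therefore gives finiteness of the other, and then the finitistic
   dimension bounds it. *)

Require Import Defs.
From HB Require Import structures.
From mathcomp Require Import all_boot all_order all_algebra.
From mathcomp Require Import boolp classical_sets reals constructive_ereal ereal.

Set Implicit Arguments.
Unset Strict Implicit.
Unset Printing Implicit Defensive.
Import Order.TTheory GRing.Theory Num.Theory.
(* Again, because [vector] also exports a [hom]. *)
Import Defs.
Local Open Scope ring_scope.

(** * Kernels, exactness and retracts of projectives *)

Section Preadditive.
Context {C : preadditiveType}.

Lemma compm0 (X Y Z : C) (f : hom Y Z) : f \oc (0 : hom X Y) = 0.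
Proof. by apply: (addIr (f \oc 0)); rewrite -compDr !add0r. Qed.

Lemma compmB (X Y Z : C) (f : hom Y Z) (g h : hom X Y) :
  f \oc (g - h) = f \oc g - f \oc h.
Proof. by apply: (addIr (f \oc h)); rewrite -compDr !subrK. Qed.

Lemma epi_idm (X : C) : epi (idm X).
Proof. by move=> Z g h; rewrite !compm1. Qed.

Lemma projective_retract (M P : C) (s : hom M P) (r : hom P M) :
  r \oc s = idm M -> projective P -> projective M.
Proof.
move=> rs projP X Y p f epip; have [g pg] := projP _ _ p (f \oc r) epip.
by exists (g \oc s); rewrite compA pg -compA rs compm1.
Qed.

Lemma projective_zero (Z : C) : zero_object Z -> projective Z.
Proof. by move=> zZ X Y p f _; exists 0; apply: (zZ Y).2. Qed.

Lemma is_kernel_mono (X Y K : C) (k : hom K X) (f : hom X Y) :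
  is_kernel k f -> mono k.
Proof.
move=> [fk0 kP] W g h kgh.
have [|l [_ ul]] := kP W (k \oc h); first by rewrite compA fk0 comp0m.
by rewrite -(ul h erefl); apply/esym/ul.
Qed.

Lemma exact_at_comp0 (X Y Z : C) (f : hom X Y) (g : hom Y Z) :
  exact_at f g -> g \oc f = 0.
Proof. by move=> [K [k [p [[gk0 _] _ ->]]]]; rewrite compA gk0 comp0m. Qed.

Lemma is_kernel_mono_comp (X Y Z K : C) (k : hom K X) (f : hom X Y)
    (j : hom Y Z) : mono j -> is_kernel k (j \oc f) -> is_kernel k f.
Proof.
move=> monoj [jfk0 kP]; split=> [|W g fg0].
  by apply: monoj; rewrite compA jfk0 compm0.
by apply: kP; rewrite -compA fg0 compm0.
Qed.

End Preadditive.

(** * Resolutions, syzygies and vanishing of cohomology *)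

Section Abelian.
Context {C : abelianType}.

(** [p] is the cokernel of some [w], and [w] factors through the kernel [k], so a map killing [k]
    also kills [w]. *)
Lemma epi_factor (K X Y Z : C) (k : hom K X) (p : hom X Y) (f : hom X Z) :
  epi p -> is_kernel k p -> f \oc k = 0 -> exists g : hom Y Z, f = g \oc p.
Proof.
move=> /epi_normal [W [w [pw0 pP]]] [_ kP] fk0.
have [h [kh _]] := kP _ _ pw0.
have [|g [gp _]] := pP _ f; first by rewrite -kh compA fk0 comp0m.
by exists g.
Qed.

Lemma projective_pd_le0 (X : C) : projective X -> pd_le X 0.
Proof.
move=> projX; have [Z zZ] := zero_object_exists (s := C).
have zP (W : C) (f g : hom W Z) : f = g by apply: (zZ W).1.
pose obj n := if n is 0%N then X else Z.
have proj n : projective (obj n) by case: n => //= _; apply: projective_zero.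
have ker0 : is_kernel (0 : hom Z X) (idm X).
  split=> [|W g]; first exact: compm0.
  rewrite comp1m => ->; exists 0; split=> [|h _]; first exact: compm0.
  exact: zP.
have ex0 : exact_at (0 : hom Z X) (idm X).
  by exists Z, 0, (idm Z); rewrite compm1; split=> //; exact: epi_idm.
have ex n : exact_at (0 : hom (obj n.+2) (obj n.+1)) (0 : hom (obj n.+1) (obj n)).
  exists Z, (idm Z), (idm Z); split; [| exact: epi_idm | exact: zP].
  split=> [|W g _]; first by rewrite compm1.
  by exists g; split=> [|h _]; [exact: comp1m | exact: zP].
exists (@ProjRes C X obj (fun n => 0) (idm X) proj (@epi_idm _ X) ex0 ex).
by case=> //= n _.
Qed.

(** A resolution [Q] of the syzygy [K] is spliced to [P] along [k \oc pr_aug Q]. *)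
Lemma pd_leS (X P K : C) (p : hom P X) (k : hom K P) n :
  projective P -> epi p -> is_kernel k p -> pd_le K n -> pd_le X n.+1.
Proof.
move=> projP epip kerk [Q Q0].
pose obj n := if n is m.+1 then Q m else P.
pose diff n : hom (obj n.+1) (obj n) :=
  if n is m.+1 then pr_diff Q m else k \oc pr_aug Q.
have proj m : projective (obj m) by case: m => //= m; apply: pr_projective.
have ex0 : exact_at (diff 0) p.
  by exists K, k, (pr_aug Q); split=> //; exact: pr_aug_epi.
have ex m : exact_at (diff m.+1) (diff m).
  case: m => [|m] /=; last exact: pr_exact.
  have [L [l [q [[ql0 lP] epiq ->]]]] := pr_exact0 Q.
  exists L, l, q; split=> //; split=> [|W g].
    by rewrite -compA ql0 compm0.
  rewrite -compA => kg0; apply: lP; apply: (is_kernel_mono kerk).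
  by rewrite kg0 compm0.
exists (@ProjRes C X obj diff p proj epip ex0 ex).
by case=> //= m; apply: Q0.
Qed.

Section Syzygy.
Context {X : C} (P : projres X) {K : C} (k : hom K (P 0%N)) (p : hom (P 1%N) K).
Hypotheses (kerk : is_kernel k (pr_aug P)) (epip : epi p)
  (diff0E : pr_diff P 0 = k \oc p).

Let syzygy_exact0 : exact_at (pr_diff P 1) p.
Proof.
have [L [l [q [kerl epiq ->]]]] := pr_exact P 0.
exists L, l, q; split=> //; apply: (is_kernel_mono_comp (is_kernel_mono kerk)).
by rewrite -diff0E.
Qed.

(** Dimension shifting becomes a conversion: [acyclic_at P n.+1 Y] unfolds to [acyclic_at] of this
    resolution in degree [n]. *)
Definition syzygy_projres : projres K :=
  @ProjRes C K (fun n => P n.+1) (fun n => pr_diff P n.+1) p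
    (fun n => @pr_projective _ _ P n.+1) epip syzygy_exact0
    (fun n => pr_exact P n.+1).

End Syzygy.

(* Vanishing of the cohomology of Hom(P, Y) in degree [n.+1]. *)
Definition acyclic_at (X : C) (P : projres X) (n : nat) (Y : C) : Prop :=
  forall f : hom (P n.+1) Y, f \oc pr_diff P n.+1 = 0 ->
    exists g : hom (P n) Y, f = g \oc pr_diff P n.

(** The cocycles on [P 1] are the maps factoring through [p], that is, the maps out of the syzygy
    [K]; the coboundaries are those that extend along [k]. *)
Lemma acyclic_at0P (X Y K : C) (P : projres X) (k : hom K (P 0%N))
    (p : hom (P 1%N) K) :
  is_kernel k (pr_aug P) -> epi p -> pr_diff P 0 = k \oc p ->
  acyclic_at P 0 Y <->
  forall f : hom K Y, exists g : hom (P 0%N) Y, f = g \oc k.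
Proof.
move=> kerk epip dE; split=> [acP f|ext f fd0].
  have pd0 : p \oc pr_diff P 1 = 0.
    apply: (is_kernel_mono kerk).
    by rewrite compA -dE compm0; apply/exact_at_comp0/pr_exact.
  have [|g fg] := acP (f \oc p); first by rewrite -compA pd0 compm0.
  by exists g; apply: epip; rewrite fg dE compA.
have [L [l [q [kerl epiq d1E]]]] := pr_exact0 (syzygy_projres kerk epip dE).
have [|f' ->] := epi_factor (f := f) epip kerl.
  by apply: epiq; rewrite comp0m -compA -[l \oc q]d1E.
by have [g ->] := ext f'; exists g; rewrite dE compA.
Qed.

(** Dimension shifting reduces to degree 0, where extending the identity of [K] along [k] splits [k]
    and makes [X] a retract of [P 0]. *)
Lemma acyclic_at_pd_le (X : C) (P : projres X) n :
  (forall Y, acyclic_at P n Y) -> pd_le X n.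
Proof.
elim: n X P => [|n IHn] X P acP;
    have [K [k [p [kerk epip dE]]]] := pr_exact0 P.
  apply: projective_pd_le0.
  have [g gk] := (acyclic_at0P K kerk epip dE).1 (acP K) (idm K).
  have [|s sE] := epi_factor (f := idm _ - k \oc g) (@pr_aug_epi _ _ P) kerk.
    by rewrite compBl comp1m -compA -gk compm1 subrr.
  apply: (projective_retract (s := s) (r := pr_aug P)); last exact: pr_projective.
  apply: (@pr_aug_epi _ _ P); rewrite -compA -sE compmB compA kerk.1 comp0m subr0.
  by rewrite compm1 comp1m.
apply: (pd_leS (@pr_projective _ _ P 0) (@pr_aug_epi _ _ P) kerk).
exact: IHn (syzygy_projres kerk epip dE) acP.
Qed.

(** With lifts [u0], [v0], [b0] to the projectives, [idm P - v0 \oc u0 - b0 \oc (a \oc p)] is killed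
    by [p] and so factors through [K], giving [h]. On [K] the last term vanishes because
    [p \oc k = 0]. *)
Lemma syzygy_stable_retract (X X' W K K' P P' : C)
    (p : hom P X) (p' : hom P' X') (k : hom K P) (k' : hom K' P')
    (u : hom X X') (v : hom X' X) (a : hom X W) (b : hom W X) :
  projective P -> epi p -> is_kernel k p ->
  projective P' -> epi p' -> is_kernel k' p' ->
  projective W -> idm X - v \oc u = b \oc a ->
  exists (u0 : hom P P') (u1 : hom K K') (v1 : hom K' K) (h : hom P K),
    u0 \oc k = k' \oc u1 /\ idm K - v1 \oc u1 = h \oc k.
Proof.
move=> projP epip kerk projP' epip' kerk' projW uvE.
have [u0 u0E] := projP _ _ p' (u \oc p) epip'.
have [v0 v0E] := projP' _ _ p (v \oc p') epip.
have [b0 b0E] := projW _ _ p b epip.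
have [|u1 [u1E _]] := kerk'.2 _ (u0 \oc k).
  by rewrite compA u0E -compA kerk.1 compm0.
have [|v1 [v1E _]] := kerk.2 _ (v0 \oc k').
  by rewrite compA v0E -compA kerk'.1 compm0.
have [|h [hE _]] := kerk.2 _ (idm _ - v0 \oc u0 - b0 \oc (a \oc p)).
  rewrite !compmB compm1 !compA v0E b0E -(compA _ _ _ _ v) u0E compA -uvE.
  by rewrite compBl comp1m subrr.
exists u0, u1, v1, h; split=> //; apply: (is_kernel_mono kerk).
rewrite [RHS]compA hE compmB compm1 compA v1E -compA u1E !compBl -!compA.
by rewrite kerk.1 !compm0 subr0 comp1m.
Qed.

(* The hypothesis says that [X] is a retract of [X'] in the category modulo
   projectives, a property inherited by syzygies. *)
Lemma acyclic_at_stable_retract (X X' W Y : C) (P : projres X) (P' : projres X')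
    (u : hom X X') (v : hom X' X) (a : hom X W) (b : hom W X) n :
  projective W -> idm X - v \oc u = b \oc a ->
  acyclic_at P' n Y -> acyclic_at P n Y.
Proof.
elim: n X X' W P P' u v a b => [|n IHn] X X' W P P' u v a b projW uvE;
    have [K [k [p [kerk epip dE]]]] := pr_exact0 P;
    have [K' [k' [p' [kerk' epip' dE']]]] := pr_exact0 P';
    have [u0 [u1 [v1 [h [u1E hkE]]]]] := syzygy_stable_retract
      (@pr_projective _ _ P 0) (@pr_aug_epi _ _ P) kerk
      (@pr_projective _ _ P' 0) (@pr_aug_epi _ _ P') kerk' projW uvE.
- move=> /(acyclic_at0P Y kerk' epip' dE') ext'.
  apply/(acyclic_at0P Y kerk epip dE) => f.
  have [g gE] := ext' (f \oc v1).
  exists (g \oc u0 + f \oc h).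
  rewrite compDl -compA u1E compA -gE -!compA -hkE compmB compm1.
  by rewrite addrC subrK.
- move=> acP'; apply: (IHn _ _ _ (syzygy_projres kerk epip dE)
    (syzygy_projres kerk' epip' dE') u1 v1 k h (@pr_projective _ _ P 0) hkE) acP'.
Qed.

(** For [X' = X] and identity maps this is independence of the resolution. *)
Lemma acyclic_at_retractl (X X' Y : C) (P : projres X) (P' : projres X')
    (u : hom X X') (v : hom X' X) n :
  v \oc u = idm X -> acyclic_at P' n Y -> acyclic_at P n Y.
Proof.
move=> vu; apply: (acyclic_at_stable_retract (u := u) (v := v) (a := 0) (b := 0)
  (@pr_projective _ _ P 0)).
by rewrite vu subrr comp0m.
Qed.

Lemma acyclic_at_retractr (X Y Y' : C) (P : projres X)
    (u : hom Y Y') (v : hom Y' Y) n :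
  v \oc u = idm Y -> acyclic_at P n Y' -> acyclic_at P n Y.
Proof.
move=> vu acP f fd0; have [|g gE] := acP (u \oc f).
  by rewrite -compA fd0 compm0.
by exists (v \oc g); rewrite -compA -gE compA vu comp1m.
Qed.

(** [P] is compared with a short resolution, whose term in degree [n.+1] is zero. *)
Lemma pd_le_acyclic_at (X Y : C) (P : projres X) m n :
  pd_le X m -> (m <= n)%N -> acyclic_at P n Y.
Proof.
move=> [Q Q0] lemn.
apply: (acyclic_at_retractl (P' := Q) (comp1m _ _ (idm X))) => f _.
by exists 0; apply: (Q0 n.+1 _ Y).2.
Qed.

Lemma Ext_of_trivialP (X Y : C) (P : projres X) n :
  (forall u v : Ext_of P n.+1 Y, u = v) <-> acyclic_at P n Y.
Proof.
split=> [triv f fd0|acP u v].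
  have fP : f \in is_cocycle (P := P) (n := n.+1) (Y := Y) by apply/eqP.
  pose Q := Quotient.quot (@coboundaries _ _ P n.+1 Y).
  have /eqP := triv (\pi_Q (Cocycle fP))%qT (\pi_Q 0)%qT.
  rewrite -Quotient.idealrBE subr0 => /asboolP [g gE].
  by exists g.
rewrite -[u]reprK -[v]reprK; apply/eqP; rewrite -Quotient.idealrBE.
case: (_ - _) => f fP; apply/asboolP.
exact: acP (eqP fP).
Qed.

End Abelian.

(** * Projective dimension through vanishing of Ext *)

Section Ext.
Context {C : abelianType} (enoughP : enough_projectives C).

Definition Ext_trivial n (X Y : C) : Prop :=
  forall u v : Ext enoughP n X Y, u = v.

Lemma pd_le_ExtP (X : C) m :
  pd_le X m <-> forall n Y, (m < n)%N -> Ext_trivial n X Y.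
Proof.
split=> [pdX [//|n] Y ltmn|triv].
  by apply/Ext_of_trivialP; apply: pd_le_acyclic_at pdX ltmn.
(* Vanishing in the single degree [m.+1] already suffices. *)
by apply: (acyclic_at_pd_le (P := chosen_projres enoughP X)) => Y;
  apply/Ext_of_trivialP/triv.
Qed.

Lemma Ext_trivial_retract n (X X' Y Y' : C) (u : hom X X') (v : hom X' X)
    (r : hom Y Y') (s : hom Y' Y) :
  v \oc u = idm X -> s \oc r = idm Y ->
  Ext_trivial n.+1 X' Y' -> Ext_trivial n.+1 X Y.
Proof.
move=> vu sr /Ext_of_trivialP triv; apply/Ext_of_trivialP.
exact: acyclic_at_retractl vu (acyclic_at_retractr sr triv).
Qed.

End Ext.

Lemma zmod_isomorphic_trivial (U V : zmodType) : zmod_isomorphic U V ->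
  (forall u v : U, u = v) <-> (forall u v : V, u = v).
Proof.
move=> [f [g fK gK]]; split=> triv u v.
  by rewrite -[u]gK -[v]gK (triv (g u) (g v)).
by rewrite -[u]fK -[v]fK (triv (f u) (f v)).
Qed.

(** Yoneda: bijections given by composition are automatically natural. *)
Lemma iso_mor_precomp (C : preadditiveType) (X Y : C) (f : hom X Y) :
  (forall Z : C, bijective (fun g : hom Y Z => g \oc f)) -> iso_mor f.
Proof.
move=> bij; have [h hK Kh] := bij X; exists (h (idm X)).
split; first exact: Kh.
by apply: (bij_inj (bij Y)); rewrite -compA Kh compm1 comp1m.
Qed.

Lemma iso_mor_postcomp (C : preadditiveType) (X Y : C) (f : hom X Y) :
  (forall W : C, bijective (fun g : hom W X => f \oc g)) -> iso_mor f.
Proof.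
move=> bij; have [h hK Kh] := bij Y; exists (h (idm Y)).
split; last exact: Kh.
by apply: (bij_inj (bij X)); rewrite compA Kh compm1 comp1m.
Qed.

(** * Units and counits of adjunctions *)

Section Adjunction.
Context {C D : preadditiveType} (L : functor C D) (G : functor D C).
Hypothesis adj : adjoint_pair L G.

(** Composing with the unit is [fmap L] followed by the adjunction bijection. *)
Lemma unit_iso : fully_faithful L ->
  forall X : C, exists eta : hom X (G (L X)), iso_mor eta.
Proof.
move=> ffL X; have [phi [phiB phiN]] := adj.
exists (phi _ _ (idm (L X))); apply: iso_mor_postcomp => W.
apply: (eq_bij (bij_comp (phiB W (L X)) (ffL W X))) => f /=.
by have := phiN _ _ _ _ f (idm _) (idm _); rewrite comp1m comp1m fmap1 comp1m.
Qed.

(** Precomposing with the counit is [fmap G] followed by the inverse adjunction bijection. *)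
Lemma counit_iso : fully_faithful G ->
  forall Y : D, exists eps : hom (L (G Y)) Y, iso_mor eps.
Proof.
move=> ffG Y; have [phi [phiB phiN]] := adj.
have [psi phiK psiK] := phiB (G Y) Y.
exists (psi (idm (G Y))); apply: iso_mor_precomp => Z.
have [psiZ phiZK psiZK] := phiB (G Y) Z.
apply: (eq_bij (bij_comp (Bijective psiZK phiZK) (ffG Y Z))) => g /=.
rewrite -[RHS]phiZK; congr psiZ.
have := phiN _ _ _ _ (idm _) g (psi (idm (G Y))).
by rewrite psiK fmap1 !compm1.
Qed.

End Adjunction.

(** * Comparison of finitistic dimensions *)

Section Findim.
Context {R : realType}.
Local Open Scope ereal_scope.

Lemma pd_ltyP (C : preadditiveType) (X : C) :
  pd (R := R) X < +oo -> exists n, pd_le X n.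
Proof. by move=> /ereal_inf_lt[_ [n pdX _] _]; exists n. Qed.

Lemma pd_le_pd (C : preadditiveType) (X : C) n :
  pd_le X n -> pd (R := R) X <= n%:R%:E.
Proof. by move=> pdX; apply: ereal_inf_lbound; exists n. Qed.

Lemma pdE (C : preadditiveType) (X : C) : (exists n, pd_le X n) ->
  exists2 n, pd_le X n & pd (R := R) X = n%:R%:E.
Proof.
move=> exX; have exb : exists n, `[< pd_le X n >].
  by have [n ?] := exX; exists n; apply/asboolP.
have [n /asboolP pdX minn] := ex_minnP exb.
exists n => //; apply/eqP; rewrite eq_le pd_le_pd //=.
apply: le_ereal_inf_tmp => _ [m pdm <-].
by rewrite lee_fin ler_nat minn //; apply/asboolP.
Qed.

(** Serves both inequalities, with [Y] either [rec_l X] or [rec_e X]. Finiteness for [Y] is what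
    lets its dimension count in the supremum. *)
Lemma Findim_le_max (C D : preadditiveType) (t : nat) :
  (forall X : C, (exists n, pd_le X n) ->
    exists2 Y : D, (exists n, pd_le Y n) &
      forall n, pd_le Y n -> pd_le X (maxn n t)) ->
  Findim R C <= maxe (Findim R D) t%:R%:E.
Proof.
move=> XY; apply: ge_ereal_sup => _ [X /pd_ltyP pdX ->].
have [Y /pdE [n pdY pdYE] YX] := XY _ pdX.
apply: (le_trans (pd_le_pd (YX _ pdY))).
have le_n : n%:R%:E <= Findim R D.
  by rewrite -pdYE; apply: ereal_sup_ubound; exists Y; rewrite // pdYE ltry.
rewrite le_max; case: (leqP n t) => _; first by rewrite lexx orbT.
by rewrite le_n.
Qed.

(** Rules out the value minus infinity, so that being finite means being below [+oo]. *)
Lemma Findim_ge0 (C : abelianType) : 0 <= Findim R C.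
Proof.
have [Z zZ] := zero_object_exists (s := C).
have [n pdZ pdZE] := pdE (ex_intro _ 0%N (projective_pd_le0 (projective_zero zZ))).
apply: (@le_trans _ _ n%:R%:E); first by rewrite lee_fin ler0n.
by rewrite -pdZE; apply: ereal_sup_ubound; exists Z; rewrite // pdZE ltry.
Qed.

End Findim.

(** * Transfer of projective dimension along [rec_e] *)

Section EventuallyHomological.
Context {A B C : abelianType}.
Context (projB : enough_projectives B) (projC : enough_projectives C).
Context (rec : recollement A B C) (t : nat).
Hypothesis ehi : Ext_iso_above projB projC (rec_e rec) t.

Lemma Ext_trivial_e n (X Y : B) : (t < n)%N ->
  Ext_trivial projB n X Y <->
  Ext_trivial projC n (rec_e rec X) (rec_e rec Y).
Proof. by move=> ltn; apply/zmod_isomorphic_trivial/ehi. Qed.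

(** Each [Z] in [C] is a retract of [rec_e (rec_r Z)], so it is enough to test Ext against objects
    in the image of [rec_e]. *)
Lemma pd_le_e (X : B) n :
  pd_le X n -> pd_le (rec_e rec X) (maxn n t).
Proof.
move=> /(pd_le_ExtP projB) triv; apply/(pd_le_ExtP projC) => -[//|m] Z.
rewrite gtn_max => /andP[ltnm lttm].
have [eps [s [_ eps_s]]] := counit_iso (rec_er rec) (@rec_r_ff _ _ _ rec) Z.
apply: (Ext_trivial_retract (comp1m _ _ (idm _)) eps_s).
exact/(Ext_trivial_e _ _ lttm)/triv.
Qed.

Lemma pd_le_of_e (X : B) n :
  pd_le (rec_e rec X) n -> pd_le X (maxn n t).
Proof.
move=> /(pd_le_ExtP projC) triv; apply/(pd_le_ExtP projB) => m Z.
by rewrite gtn_max => /andP[ltnm lttm]; apply/(Ext_trivial_e _ _ lttm)/triv.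
Qed.

End EventuallyHomological.

Lemma pd_le_retract (C : abelianType) (projC : enough_projectives C)
    (X X' : C) (u : hom X X') (v : hom X' X) n :
  v \oc u = idm X -> pd_le X' n -> pd_le X n.
Proof.
move=> vu /(pd_le_ExtP projC) triv; apply/(pd_le_ExtP projC) => -[//|m] Z ltnm.
exact: (Ext_trivial_retract vu (comp1m _ _ (idm Z))) (triv _ _ ltnm).
Qed.

Theorem theorem5p11 (R : realType) (A B C : abelianType)
  (projA : enough_projectives A) (injA : enough_injectives A)
  (projB : enough_projectives B) (injB : enough_injectives B)
  (projC : enough_projectives C) (injC : enough_injectives C)
  (rec : recollement A B C)
  (finlenA : finite_length_category A)
  (coversB : has_projective_covers B)
  (t : nat)
  (ehi : t_eventually_homological_iso projB projC (rec_e rec) t) :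
  [/\ (Findim R C <= maxe (Findim R B) t%:R%:E)%E,
      (Findim R B <= maxe (Findim R C) t%:R%:E)%E &
      Findim R B \is a fin_num <-> Findim R C \is a fin_num].
Proof.
have [_ ext_iso _] := ehi.
have leCB : (Findim R C <= maxe (Findim R B) t%:R%:E)%E.
  apply: Findim_le_max => X [n pdX].
  (* [X] is isomorphic to [rec_e (rec_l X)]: [eta_s] yields finite dimension for [rec_l X], and
     [s_eta] carries the bound back to [X]. *)
  have [eta [s [s_eta eta_s]]] :=
    unit_iso (rec_le rec) (@rec_l_ff _ _ _ rec) X.
  exists (rec_l rec X) => [|m pdlX].
    exists (maxn n t); apply: (pd_le_of_e ext_iso).
    exact: (pd_le_retract projC eta_s).
  exact: (pd_le_retract projC s_eta) (pd_le_e ext_iso pdlX).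
have leBC : (Findim R B <= maxe (Findim R C) t%:R%:E)%E.
  apply: Findim_le_max => X [n pdX]; exists (rec_e rec X).
    by exists (maxn n t); apply: (pd_le_e ext_iso).
  by move=> m; apply: (pd_le_of_e ext_iso).
split=> //; rewrite !ge0_fin_numE ?Findim_ge0 //.
by split=> lty; [apply: le_lt_trans leCB _ | apply: le_lt_trans leBC _];
  rewrite gt_max lty ltry.
Qed.
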